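(* Let $A$ be an MPTQ set of real numbers. The following hold. (1) If $A$ contains only positive numbers, then $|A|\ge 8$. (2) If $A$ contains negative numbers (i.e. at least one element of $A$ is negative), then $|A|\ge 5$.
   Context: For a finite set $A\subset\mathbb{R}\setminus\{0\}$, define $A\cdot A=\{ab \mid a,b\in A\}$ and $A/A=\{a/b\mid a,b\in A\}$. The set $A$ is MPTQ (more product than quotient) if $|A\cdot A|>|A/A|$. In particular an MPTQ set is by definition a finite set of nonzero real numbers. *)

(* Defs.v *)
(* MathComp: R : realType is the field of real numbers; finite sets of reals
   are finmap's {fset R}. *)
From mathcomp Require Import all_boot all_order all_algebra.
From mathcomp Require Import finmap reals.

Set Implicit Arguments.
Unset Strict Implicit.
Unset Printing Implicit Defensive.

Import Order.TTheory GRing.Theory Num.Theory.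

Local Open Scope fset_scope.
Local Open Scope ring_scope.

Definition product_set (R : realType) (A : {fset R}) : {fset R} :=
  [fset a * b | a in A, b in A].

Definition quotient_set (R : realType) (A : {fset R}) : {fset R} :=
  [fset a / b | a in A, b in A].

(* The condition 0 \notin A is part of the definition; it also makes every
   quotient above a genuine one, since MathComp sets 0^-1 = 0. *)
Definition MPTQ (R : realType) (A : {fset R}) : Prop :=
  0 \notin A /\ (#|` quotient_set A| < #|` product_set A|)%N.

(* Main.v *)
(** Write the elements of [A] as [c * (-1)^s * prod_k h_k^(v_k)] with real
    parameters [h_k > 1] and exponent vectors [v] of natural numbers: sorting
    [A] by absolute value, one can start from the ratios of consecutive
    absolute values as parameters.  Distinct signed exponent vectors of
    products bound [|A.A|] from above; a chain of quotients that is increasing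
    coordinatewise in the exponents bounds [|A/A|] from below.  If these bounds
    do not yet give [|A.A| <= |A/A|], compare two parameters: when [h_i < h_j]
    replace [h_j] by [h_j / h_i > 1], when [h_j < h_i] do the converse, and when
    [h_i = h_j] eliminate one of them; in each case the exponents remain natural
    numbers.  For at most 7 positive elements, and for at most 4 elements of
    arbitrary signs, a finite tree of such comparisons settles all cases. *)
Require Import Defs.
From mathcomp Require Import all_boot all_order all_algebra.
From mathcomp Require Import finmap reals.

Set Implicit Arguments.
Unset Strict Implicit.
Unset Printing Implicit Defensive.

Import Order.TTheory GRing.Theory Num.Theory.

(** * Signed exponent vectors and decision trees *)

(* The nested conditionals here and below, in place of [&&], make both
   [vm_compute] and the lazy conversion of the kernel stop early. *)
Fixpoint vle (u v : seq nat) : bool :=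
  match u, v with
  | x :: u', y :: v' => if x <= y then vle u' v' else false
  | [::], _ => true
  | _, _ => false
  end.

Fixpoint vlt (u v : seq nat) : bool :=
  match u, v with
  | x :: u', y :: v' =>
    if x < y then vle u' v' else if x <= y then vlt u' v' else false
  | _, _ => false
  end.

Fixpoint vadd (u v : seq nat) : seq nat :=
  match u, v with
  | x :: u', y :: v' => x + y :: vadd u' v'
  | [::], _ => v
  | _, [::] => u
  end.

Definition point := (bool * seq nat)%type.

Definition pmul (p q : point) : point := (p.1 (+) q.1, vadd p.2 q.2).

Fixpoint products (s : seq point) : seq point :=
  if s is p :: s' then [seq pmul p q | q <- s] ++ products s' else [::].

Definition nproducts (s : seq point) : nat := size (undup (products s)).

Definition nth_point (s : seq point) (i : nat) : point := nth (false, [::]) s i.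

(* The pair [(i, j)] stands for the quotient of the [i]-th point by the [j]-th
   one. *)
Definition quot_lt (s : seq point) (ij kl : nat * nat) : bool :=
  let p := nth_point s in
  let: (i, j) := ij in let: (k, l) := kl in
  let b := (p i).1 (+) (p j).1 in let c := (p k).1 (+) (p l).1 in
  if b (+) c then c
  else vlt (vadd (p i).2 (p l).2) (vadd (p k).2 (p j).2).

(** The exponents of [h_i^a * h_j^b = h_i^(a+b) * (h_j/h_i)^b], where [h_j/h_i] takes over position
    [j]. *)
Definition merge_param (i j : nat) (p : point) : point :=
  (p.1, set_nth 0 p.2 i (nth 0 p.2 i + nth 0 p.2 j)).

(** After a merge with [h_i = h_j] the new parameter would be 1. Zeroing its exponent instead of
    deleting it keeps the other indices. *)
Definition drop_param (j : nat) (p : point) : point := (p.1, set_nth 0 p.2 j 0).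

(* The subtrees of [Node i j] are for [h_i < h_j], [h_j < h_i] and
   [h_i = h_j]; a leaf holds a chain of quotients. *)
Inductive tree :=
  | Leaf of seq (nat * nat)
  | Node of nat & nat & tree & tree & tree.

(* [m] is an upper bound for the number of products, which can improve only in
   the equality case. *)
Fixpoint check (t : tree) (m : nat) (s : seq point) : bool :=
  match t with
  | Leaf c =>
    if m <= size c then
      if all (fun ij => (ij.1 < size s) && (ij.2 < size s)) c
      then sorted (quot_lt s) c else false
    else false
  | Node i j t_lt t_gt t_eq =>
    if i == j then false else
    let s' := map (merge_param i j) s in
    if check t_lt m s' then
      if check t_gt m (map (merge_param j i) s) then
        let u := map (drop_param j) s' in check t_eq (nproducts u) u
      else false
    else false
  end.

(* Exponents for numbers sorted by absolute value: [gaps] tells which absolute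
   values are strictly smaller than the next one, and the [l]-th parameter is
   their ratio. *)
Definition start (signs gaps : seq bool) : seq point :=
  [seq (nth false signs k,
        [seq ((l < k) && nth false gaps l : nat) | l <- iota 0 (size gaps)])
  | k <- iota 0 (size signs)].

(** * Search for a decision tree *)

(* Nothing below has to be proved about the search, since its result is
   submitted to [check]. *)
Fixpoint lex_le (u v : seq nat) : bool :=
  match u, v with
  | x :: u', y :: v' =>
    if x < y then true else if x <= y then lex_le u' v' else false
  | _, _ => true
  end.

Definition candidate := (seq nat * (nat * nat))%type.

(* Adding the exponents of the last, largest point keeps those of the quotients
   nonnegative; sorting by total degree first makes the list compatible with
   [vlt]. *)
Definition quotients (b : bool) (s : seq point) : seq candidate :=
  let p := nth_point s in
  let idx := iota 0 (size s) in
  let top := (last (false, [::]) s).2 in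
  let exponents i j := [seq x.1 - x.2 | x <- zip (vadd (p i).2 top) (p j).2] in
  let weighted v := sumn v :: v in
  sort (fun c d => lex_le (weighted c.1) (weighted d.1))
    [seq (exponents i j, (i, j))
    | i <- idx, j <- [seq j <- idx | (p i).1 (+) (p j).1 == b]].

(** Dynamic programming: each entry of [chains] is a longest chain ending at one candidate, stored
    backwards with its length. *)
Definition longest_chain (cs : seq candidate) : seq (nat * nat) :=
  let longer (x y : nat * seq candidate) := if x.1 < y.1 then y else x in
  let longest := foldl longer (0, [::]) in
  let extend chains c :=
    let below x := if x.2 is d :: _ then vlt d.1 c.1 else false in
    let x := longest (filter below chains) in (x.1.+1, c :: x.2) :: chains in
  rev [seq c.2 | c <- (longest (foldl extend [::] cs)).2].

Fixpoint conflicts (cs : seq candidate) : seq (seq nat * seq nat) :=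
  match cs with
  | c :: (d :: _) as cs' =>
    if vle c.1 d.1 then conflicts cs' else (c.1, d.1) :: conflicts cs'
  | _ => [::]
  end.

(** When the exponents at [i] and [j] change in opposite directions, comparing [h_i] with [h_j] may
    make [u] and [v] comparable. *)
Definition separates (ij : nat * nat) (uv : seq nat * seq nat) : bool :=
  let: (i, j) := ij in let: (u, v) := uv in
  let less k := nth 0 u k < nth 0 v k in
  let greater k := nth 0 v k < nth 0 u k in
  if less i then greater j else if greater i then less j else false.

Definition best_pair (d : nat) (uvs : seq (seq nat * seq nat)) : nat * nat :=
  let better (x y : nat * (nat * nat)) := if x.1 <= y.1 then y else x in
  (foldl better (0, (0, 0))
     [seq (count (separates (i, j)) uvs, (i, j))
     | i <- iota 0 d, j <- iota i.+1 (d - i.+1)]).2.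

Fixpoint search (fuel m : nat) (s : seq point) : tree :=
  let qs_pos := quotients false s in
  let qs_neg := quotients true s in
  (* Positive quotients come first, as [quot_lt] demands. *)
  let c := longest_chain qs_pos ++ longest_chain qs_neg in
  if m <= size c then Leaf c else
  if fuel is n.+1 then
    let d := size (last (false, [::]) s).2 in
    let: (i, j) := best_pair d (conflicts qs_pos ++ conflicts qs_neg) in
    let s' := map (merge_param i j) s in
    let u := map (drop_param j) s' in
    Node i j (search n m s') (search n m (map (merge_param j i) s))
             (search n (nproducts u) u)
  else Leaf [::].

Fixpoint bitseqs (n : nat) : seq bitseq :=
  if n is k.+1 then [seq b :: m | b <- [:: true; false], m <- bitseqs k]
  else [:: [::]].

Definition starts : seq (seq point) :=
  [seq start (nseq n false) (nseq n.-1 true) | n <- iota 0 8] ++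
  flatten [seq [seq start signs gaps | signs <- bitseqs n, gaps <- bitseqs n.-1]
          | n <- iota 0 5].

(* The trees are stored in normal form, so that a kernel without [vm_compute]
   only has to run [check]. *)
Definition trees : seq tree :=
  Eval vm_compute in [seq search 40 (nproducts s) s | s <- starts].

Lemma trees_correct : all2 (fun t s => check t (nproducts s) s) trees starts.
Proof. by vm_compute. Qed.

Lemma check_starts s : s \in starts -> exists t, check t (nproducts s) s.
Proof.
move: trees_correct; elim: trees starts => [|t ts IH] [|s' ss] //=.
move=> /andP[ok /IH ts_ok]; rewrite inE => /orP[/eqP-> | //]; by exists t.
Qed.

Lemma mem_bitseqs m : m \in bitseqs (size m).
Proof.
elim: m => // b m IH; apply: allpairs_f => //.
by case: b; rewrite !inE.
Qed.

(** * Evaluation of signed exponent vectors *)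

Section Evaluation.
Variable R : realType.
Implicit Types (A : {fset R}) (h : nat -> R) (c : R) (s : seq point).

Local Open Scope ring_scope.

Definition monomial h (v : seq nat) : R :=
  \prod_(k < size v) h k ^+ nth 0%N v k.

Definition value h (p : point) : R := (-1) ^+ p.1 * monomial h p.2.

Definition represents c h s A : Prop :=
  A =i [seq c * value h p | p <- s].

Lemma monomial_nil h : monomial h [::] = 1.
Proof. exact: big_ord0. Qed.

Lemma monomial_cons h n v :
  monomial h (n :: v) = h 0%N ^+ n * monomial (h \o S) v.
Proof. by rewrite /monomial big_ord_recl. Qed.

Lemma monomial_vadd h u v :
  monomial h (vadd u v) = monomial h u * monomial h v.
Proof.
elim: u v h => [|x u IH] [|y v] h; rewrite ?monomial_nil ?mul1r ?mulr1 //=.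
by rewrite !monomial_cons IH exprD mulrACA.
Qed.

Lemma monomial_ge1 h v : (forall k, 1 < h k) -> 1 <= monomial h v.
Proof.
move=> h1; apply: (big_ind (fun x => 1 <= x)) => // [x y|k _].
  exact: mulr_ege1.
exact/exprn_ege1/ltW.
Qed.

Lemma monomial_gt0 h v : (forall k, 1 < h k) -> 0 < monomial h v.
Proof. by move/monomial_ge1 => /(_ v); apply: lt_le_trans. Qed.

Lemma monomial_le h u v :
  (forall k, 1 < h k) -> vle u v -> monomial h u <= monomial h v.
Proof.
elim: u v h => [|x u IH] [|y v] h h1 //=.
- by rewrite monomial_nil monomial_ge1.
- case: leqP => // xy uv; rewrite !monomial_cons ler_pM ?IH //.
  + by rewrite exprn_ge0 // ltW // (lt_trans ltr01).
  + by apply/ltW/monomial_gt0 => k /=.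
  + by rewrite ler_weXn2l // ltW.
  + by move=> k /=.
Qed.

Lemma monomial_lt h u v :
  (forall k, 1 < h k) -> vlt u v -> monomial h u < monomial h v.
Proof.
elim: u v h => [|x u IH] [|y v] h h1 //=.
have h0 n : 0 < h 0%N ^+ n by rewrite exprn_gt0 // (lt_trans ltr01).
have h1' k : 1 < (h \o S) k by exact: h1.
rewrite !monomial_cons; case: ltnP => [xy uv|yx].
  apply: (@lt_le_trans _ _ (h 0%N ^+ y * monomial (h \o S) u)).
    by rewrite ltr_pM2r ?monomial_gt0 // ltr_eXn2l.
  by rewrite ler_pM2l // monomial_le.
case: leqP => // xy uv; have -> : x = y by apply/eqP; rewrite eqn_leq xy yx.
by rewrite ltr_pM2l // IH.
Qed.

Lemma monomial_widen h v N : (size v <= N)%N ->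
  monomial h v = \prod_(k < N) h k ^+ nth 0%N v k.
Proof.
move=> vN; rewrite /monomial -!(big_mkord xpredT (fun k => h k ^+ nth 0%N v k)).
rewrite [RHS](big_cat_nat _ vN) //= [X in _ * X]big1_seq ?mulr1 // => k.
by rewrite mem_index_iota => /andP[_ /andP[vk _]]; rewrite nth_default.
Qed.

(** Cross-multiplying replaces an exponent without subtraction or division. *)
Lemma monomial_set_nth h v i n :
  monomial h (set_nth 0%N v i n) * h i ^+ nth 0%N v i = monomial h v * h i ^+ n.
Proof.
pose N := maxn i.+1 (size v); have iN : (i < N)%N by rewrite leq_max leqnn.
rewrite (@monomial_widen _ v N) ?leq_maxr //.
rewrite (@monomial_widen _ _ N) ?size_set_nth //.
rewrite (bigD1 (Ordinal iN)) //= [in RHS](bigD1 (Ordinal iN)) //= nth_set_nth /= eqxx.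
rewrite mulrC mulrA [RHS]mulrAC; congr (_ * _).
apply: eq_bigr => k; rewrite -val_eqE /= => /negPf ki.
by rewrite nth_set_nth /= ki.
Qed.

Lemma monomial_update h v j x :
  monomial (fun k => if k == j then x else h k) v * h j ^+ nth 0%N v j
  = monomial h v * x ^+ nth 0%N v j.
Proof.
pose N := maxn j.+1 (size v); have jN : (j < N)%N by rewrite leq_max leqnn.
rewrite !(@monomial_widen _ v N) ?leq_maxr //.
rewrite (bigD1 (Ordinal jN)) //= [in RHS](bigD1 (Ordinal jN)) //= eqxx mulrC mulrA [RHS]mulrAC; congr (_ * _).
by apply: eq_bigr => k; rewrite -val_eqE /= => /negPf ->.
Qed.

Lemma value_pmul h p q : value h (pmul p q) = value h p * value h q.
Proof. by rewrite /value /= signr_addb monomial_vadd mulrACA. Qed.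

Lemma value_merge_param h i j p : i != j -> h i != 0 -> h j != 0 ->
  value (fun k => if k == j then h j / h i else h k) (merge_param i j p)
  = value h p.
Proof.
case: p => b v ij hi0 hj0; rewrite /value /=; congr (_ * _).
set w := set_nth _ _ _ _; pose e := nth 0%N v j.
have we : nth 0%N w j = e by rewrite nth_set_nth /= eq_sym (negPf ij).
have := monomial_update h w j (h j / h i).
have := monomial_set_nth h v i (nth 0%N v i + nth 0%N v j).
rewrite -/w we -/e exprD expr_div_n => Ew Em.
have hie n : h i ^+ n != 0 by rewrite expf_neq0.
have hje n : h j ^+ n != 0 by rewrite expf_neq0.
apply: (mulIf (hje e)); rewrite Em; apply: (mulIf (hie (nth 0%N v i))).
rewrite mulrAC Ew -!mulrA; congr (_ * _).
by rewrite mulrC; congr (_ * _); rewrite mulrCA mulfV ?mulr1.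
Qed.

Lemma value_drop_merge h i j p : i != j -> h i = h j -> h i != 0 ->
  value h (drop_param j (merge_param i j p)) = value h p.
Proof.
case: p => b v ij hij hi0; rewrite /value /=; congr (_ * _).
set w := set_nth _ v _ _.
have we : nth 0%N w j = nth 0%N v j by rewrite nth_set_nth /= eq_sym (negPf ij).
have := monomial_set_nth h w j 0; have := monomial_set_nth h v i (nth 0%N v i + nth 0%N v j).
rewrite -/w we expr0 mulr1 -hij exprD => Ew Ed.
have hie n : h i ^+ n != 0 by rewrite expf_neq0.
apply: (mulIf (hie (nth 0%N v j))); rewrite Ed.
by apply: (mulIf (hie (nth 0%N v i))); rewrite Ew -mulrA [X in _ * X]mulrC.
Qed.

(** * Bounds for the product set and the quotient set *)

Lemma products_pmul s p q : p \in s -> q \in s ->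
  pmul p q \in products s \/ pmul q p \in products s.
Proof.
elim: s => //= r s IH; rewrite !inE => /orP[/eqP-> | ps] /orP[/eqP-> | qs].
- by left; rewrite eqxx.
- by left; rewrite mem_cat map_f ?orbT.
- by right; rewrite mem_cat map_f ?orbT.
- by case: (IH ps qs) => mem_pq; [left|right]; rewrite mem_cat mem_pq !orbT.
Qed.

(** Every product is [c ^+ 2] times the value of a vector in [products s]; different vectors may
    share a value. *)
Lemma card_product_set_le c h s A :
  represents c h s A -> (#|` product_set A| <= nproducts s)%N.
Proof.
move=> sA; rewrite /nproducts -(size_map (fun r => c ^+ 2 * value h r) (undup _)).
apply: uniq_leq_size; first exact: fset_uniq.
move=> x /imfset2P[a aA [b bA ->]].
move: aA bA; rewrite !sA => /mapP[p ps ->] /mapP[q qs ->].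
rewrite mulrACA -expr2; apply/mapP.
case: (products_pmul ps qs) => [pq | qp].
  by exists (pmul p q); rewrite ?mem_undup // value_pmul.
by exists (pmul q p); rewrite ?mem_undup // value_pmul (mulrC (value h q)).
Qed.

(* Strict order listing the positive reals before the negative ones, both by
   increasing absolute value. *)
Definition sign_abs_lt (x y : R) : bool :=
  if (x < 0) (+) (y < 0) then y < 0 else `|x| < `|y|.

Lemma sign_abs_lt_irr : irreflexive sign_abs_lt.
Proof. by move=> x; rewrite /sign_abs_lt addbb ltxx. Qed.

Lemma sign_abs_lt_trans : transitive sign_abs_lt.
Proof.
move=> y x z; rewrite /sign_abs_lt.
by case: (x < 0); case: (y < 0); case: (z < 0) => //=; apply: lt_trans.
Qed.

Definition quotient_value h s (ij : nat * nat) : R :=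
  value h (nth_point s ij.1) / value h (nth_point s ij.2).

Lemma quot_lt_value h s ij kl : (forall k, 1 < h k) ->
  quot_lt s ij kl ->
  sign_abs_lt (quotient_value h s ij) (quotient_value h s kl).
Proof.
move=> h1; case: ij kl => [i j] [k l].
pose M p := monomial h (nth_point s p).2.
have M0 p : 0 < M p by exact: monomial_gt0.
have qE p q : quotient_value h s (p, q) =
    (-1) ^+ ((nth_point s p).1 (+) (nth_point s q).1) * (M p / M q).
  rewrite /quotient_value /value /= invfM mulrACA signr_addb; congr (_ * _ * _).
  by case: (_.1); rewrite ?expr1 ?expr0 ?invrN invr1.
have MM p q : 0 < M p / M q by rewrite divr_gt0.
rewrite /quot_lt /sign_abs_lt !qE !normrMsign !(gtr0_norm (MM _ _)).
rewrite !pmulr_llt0 // !(@signr_lt0 R).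
(* For equal signs, cross-multiplication turns the comparison of quotients into one of monomials
   with natural exponents. *)
case: ifP => // _ uv; rewrite (ltr_pdivrMr _ _ (M0 j)) mulrAC (ltr_pdivlMr _ _ (M0 l)).
by rewrite /M -!monomial_vadd; apply: monomial_lt.
Qed.

(** The factor [c] cancels in quotients, and values increasing in a strict order are distinct. *)
Lemma card_quotient_set_ge c h s A (ch : seq (nat * nat)) :
    c != 0 -> (forall k, 1 < h k) -> represents c h s A ->
    all (fun ij => (ij.1 < size s)%N && (ij.2 < size s)%N) ch ->
    sorted (quot_lt s) ch ->
  (size ch <= #|` quotient_set A|)%N.
Proof.
move=> c0 h1 sA /allP ch_s ch_sorted; rewrite -(size_map (quotient_value h s) ch).
apply: uniq_leq_size.
  apply: (sorted_uniq sign_abs_lt_trans sign_abs_lt_irr).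
  rewrite sorted_map; apply: sub_sorted ch_sorted => ij kl.
  exact: quot_lt_value.
have memA i : (i < size s)%N -> c * value h (nth_point s i) \in A.
  by move=> i_s; rewrite sA; apply/map_f/mem_nth.
move=> _ /mapP[[i j] /ch_s/andP[/= i_s j_s] ->].
apply/imfset2P; exists (c * value h (nth_point s i)); rewrite ?inE ?memA //.
exists (c * value h (nth_point s j)); rewrite ?inE ?memA //.
by rewrite invfM mulrACA mulfV ?mul1r.
Qed.

(** * Soundness of the decision trees *)

Lemma represents_map c h h' s A (f : point -> point) :
  (forall p, value h' (f p) = value h p) ->
  represents c h s A -> represents c h' (map f s) A.
Proof.
move=> fE sA x; rewrite sA -map_comp; congr (_ \in _).
by apply: eq_map => p /=; rewrite fE.
Qed.

Lemma represents_merge c h s A i j :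
    i != j -> (forall k, 1 < h k) -> h i < h j -> represents c h s A ->
  exists2 h', forall k, 1 < h' k
            & represents c h' (map (merge_param i j) s) A.
Proof.
move=> ij h1 hij sA; have h0 k : 0 < h k by exact: lt_trans (h1 k).
exists (fun k => if k == j then h j / h i else h k) => [k|].
  by case: ifP => // _; rewrite ltr_pdivlMr ?mul1r.
apply: represents_map sA => p; by apply: value_merge_param; rewrite // gt_eqF.
Qed.

Lemma check_sound t m c h s A :
    c != 0 -> (forall k, 1 < h k) -> represents c h s A ->
    (#|` product_set A| <= m)%N -> check t m s ->
  (#|` product_set A| <= #|` quotient_set A|)%N.
Proof.
move=> c0; elim: t m h s => [ch | i j t1 IH1 t2 IH2 t3 IH3] m h s h1 sA mA /=.
  case: leqP => // m_ch; case: ifP => // ch_s ch_sorted.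
  apply: leq_trans mA (leq_trans m_ch _).
  exact: card_quotient_set_ge c0 h1 sA ch_s ch_sorted.
case: eqVneq => // ij; case: ifP => // ck1; case: ifP => // ck2 ck3.
have h0 k : h k != 0 by rewrite gt_eqF // (lt_trans ltr01).
case: (ltgtP (h i) (h j)) => hij.
- by have [h' h'1 s'A] := represents_merge ij h1 hij sA; exact: IH1 h'1 s'A mA ck1.
- have ji : j != i by rewrite eq_sym.
  by have [h' h'1 s'A] := represents_merge ji h1 hij sA; exact: IH2 h'1 s'A mA ck2.
have s'A : represents c h (map (drop_param j) (map (merge_param i j) s)) A.
  rewrite -map_comp; apply: represents_map sA => p /=.
  exact: value_drop_merge.
exact: IH3 h1 s'A (card_product_set_le s'A) ck3.
Qed.

(** * Starting exponents of a sorted sequence *)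

Lemma telescope_gaps (a : seq R) k :
    (forall l, (l < size a)%N -> `|a`_l| != 0) -> (k < size a)%N ->
  \prod_(l < k) (`|a`_l.+1| / `|a`_l|) = `|a`_k| / `|a`_0|.
Proof.
move=> an0 ka; rewrite -(big_mkord xpredT (fun l => `|a`_l.+1| / `|a`_l|)).
case: k ka => [|k] ka; first by rewrite big_geq // divff ?an0.
rewrite (@telescope_prodf _ _ _ (fun l => `|a`_l|)) // => l /andP[_ lk].
by rewrite an0 // (ltn_trans lk).
Qed.

Lemma represents_start (a : seq R) :
    0 \notin a -> sorted (fun x y => `|x| <= `|y|) a ->
    let gaps := [seq `|a`_l| < `|a`_l.+1| | l <- iota 0 (size a).-1] in
  exists c h, [/\ c != 0, forall k, 1 < h k &
    forall A, A =i a -> represents c h (start [seq x < 0 | x <- a] gaps) A].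
Proof.
move=> a0 a_sorted gaps.
have an0 k : (k < size a)%N -> `|a`_k| != 0.
  by move=> ka; rewrite normr_eq0; apply: contraNneq a0 => <-; apply: mem_nth.
(* Where there is no strict gap the exponent is 0, so any value above 1, here 2, will do. *)
pose h k := if (0 < `|a`_k|) && (`|a`_k| < `|a`_k.+1|)
            then `|a`_k.+1| / `|a`_k| else 2.
have h1 k : 1 < h k.
  rewrite /h; case: ifP => [/andP[p0 lt]|_]; last by rewrite ltr1n.
  by rewrite ltr_pdivlMr ?mul1r.
have hE k : (k.+1 < size a)%N ->
    h k ^+ (`|a`_k| < `|a`_k.+1|)%R = `|a`_k.+1| / `|a`_k|.
  move=> ka; have k0 := an0 k (ltnW ka).
  rewrite /h lt_def k0 normr_ge0 /=; case: ltP => [_|le]; first by rewrite expr1.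
  have := sortedP 0 a_sorted _ ka; rewrite expr0 => ge.
  by have -> : `|a`_k.+1| = `|a`_k| by [apply/eqP; rewrite eq_le le ge]; rewrite divff.
(* The smallest absolute value; the empty sequence gets 1 to keep [c] nonzero. *)
pose c : R := if a is x :: _ then `|x| else 1.
have c0 : c != 0.
  by move: an0; rewrite /c; case: (a) => [|x a'] // => [_|/(_ 0%N)->//]; apply: oner_neq0.
exists c, h; split=> // A Aa x; rewrite Aa /represents /start size_map -map_comp.
rewrite -{1}(mkseq_nth 0 a) /mkseq; congr (_ \in _).
apply/eq_in_map => k; rewrite mem_iota add0n /= => ka.
rewrite /value /= (nth_map 0) //.
have gsz : size gaps = (size a).-1 by rewrite size_map size_iota.
rewrite (@monomial_widen _ _ (size a).-1) ?size_map ?size_iota ?gsz //.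
rewrite (eq_bigr (fun l : 'I_(size a).-1 =>
    if (l < k)%N then `|a`_l.+1| / `|a`_l| else 1)); last first.
  move=> l _; rewrite (nth_map 0%N) ?size_iota ?nth_iota //=.
  case: ifP => lk /=; last by rewrite expr0.
  rewrite add0n (nth_map 0%N) ?size_iota ?nth_iota // add0n hE //.
  exact: leq_ltn_trans lk ka.
rewrite -big_mkcond /= -(big_ord_widen _ (fun l => `|a`_l.+1| / `|a`_l|)); last first.
  by rewrite -ltnS prednK // (leq_ltn_trans _ ka).
rewrite telescope_gaps // mulrCA mulrC {1}[a`_k]numEsign mulrC; congr (_ * _).
have -> : c = `|a`_0| by rewrite /c; case: (a) ka.
by rewrite mulrC divfK // an0 // (leq_ltn_trans _ ka).
Qed.

Lemma card_product_set_le_quotient_set (a : seq R) A :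
    0 \notin a -> sorted (fun x y => `|x| <= `|y|) a -> A =i a ->
    start [seq x < 0 | x <- a]
          [seq `|a`_l| < `|a`_l.+1| | l <- iota 0 (size a).-1] \in starts ->
  (#|` product_set A| <= #|` quotient_set A|)%N.
Proof.
move=> a0 a_sorted Aa /check_starts[t ck].
have [c [h [c0 h1 /(_ _ Aa) sA]]] := represents_start a0 a_sorted.
exact: check_sound c0 h1 sA (card_product_set_le sA) ck.
Qed.

(** Distinct positive numbers have distinct absolute values, so all gaps are strict and each size
    needs just one start. *)
Lemma start_pos_mem (a : seq R) :
    uniq a -> (forall x, x \in a -> 0 < x) -> (size a < 8)%N ->
    sorted (fun x y => `|x| <= `|y|) a ->
  start [seq x < 0 | x <- a]
        [seq `|a`_l| < `|a`_l.+1| | l <- iota 0 (size a).-1] \in starts.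
Proof.
move=> a_uniq a_pos a_lt8 a_sorted.
set signs := map _ _; set gaps := map _ _.
have -> : signs = nseq (size a) false.
  have <- : size signs = size a by rewrite size_map.
  apply/all_pred1P/allP => _ /mapP[x xa ->].
  by rewrite /= ltNge ltW ?a_pos.
have -> : gaps = nseq (size a).-1 true.
  have <- : size gaps = (size a).-1 by rewrite size_map size_iota.
  apply/all_pred1P/allP => b /mapP[l]; rewrite mem_iota add0n /= => la ->.
  have la' : (l.+1 < size a)%N by case: (size a) la.
  rewrite /= eqb_id lt_neqAle (sortedP 0 a_sorted) // andbT.
  rewrite !gtr0_norm ?a_pos ?mem_nth ?(ltnW la') //.
  by rewrite nth_uniq ?(ltnW la') // neq_ltn leqnn.
rewrite mem_cat; apply/orP; left; apply/mapP; exists (size a) => //.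
by rewrite mem_iota.
Qed.

Lemma start_mem (signs gaps : bitseq) :
    (size signs < 5)%N -> size gaps = (size signs).-1 ->
  start signs gaps \in starts.
Proof.
move=> signs_lt5 gaps_size; rewrite mem_cat; apply/orP; right.
apply/flatten_mapP; exists (size signs); first by rewrite mem_iota.
by apply: allpairs_f; rewrite -?gaps_size mem_bitseqs.
Qed.

End Evaluation.

Local Open Scope fset_scope.
Local Open Scope ring_scope.

Theorem theorem1p4 (R : realType) (A : {fset R}) (hA : MPTQ A) :
  ((forall x : R, x \in A -> 0 < x) -> (8 <= #|` A|)%N) /\
  ((exists2 x : R, x \in A & x < 0) -> (5 <= #|` A|)%N).
Proof.
case: hA => A0; rewrite ltnNge => /negP lt_QP.
pose a := sort (fun x y : R => `|x| <= `|y|) A.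
have Aa : A =i a by move=> x; rewrite mem_sort.
have a0 : 0 \notin a by rewrite -Aa.
have a_size : size a = #|` A| by rewrite size_sort.
have a_sorted : sorted (fun x y : R => `|x| <= `|y|) a.
  by apply: sort_sorted => x y; apply: le_total.
split=> [A_pos | _]; rewrite leqNgt -a_size; apply/negP => a_lt; apply: lt_QP;
  apply: (card_product_set_le_quotient_set a0 a_sorted Aa).
  apply: start_pos_mem => //; first by rewrite sort_uniq fset_uniq.
  by move=> x; rewrite -Aa; apply: A_pos.
by apply: start_mem; rewrite ?size_map ?size_iota.
Qed.
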